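(* For a real number $t$ let $T(t)\subset\mathbb{R}^7$ be the simplex with vertices $$(1,0,0,0,0,0,1),\ (1,0,1,t,1,1,0),\ (0,1,1,1-t,0,1,1),\ (0,0,0,t,1,1,0),$$ $$(0,1,1,1-t,0,0,0),\ (1,1,0,t,1,1,0),\ (0,1,1,1-t,1,0,1),\ (1,0,0,1,0,0,1).$$ If $t\in\left[\frac14,\frac34\right]$, then the simplex $7T(t)$ is circumscribed around $Q_7=[0,1]^7$.
   Context: For a nondegenerate simplex $S\subset\mathbb{R}^n$ and $\sigma>0$, $\sigma S$ denotes the image of $S$ under the homothety with center at the center of gravity of $S$ (the arithmetic mean of its vertices) and coefficient $\sigma$. An $n$-dimensional simplex $T$ is circumscribed around a convex body $C\subset\mathbb{R}^n$ if $C\subset T$ and each $(n-1)$-dimensional face of $T$ contains a point of $C$. *)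

(* Defs.v *)
From mathcomp Require Import all_boot all_order all_algebra.
From mathcomp Require Import classical_sets reals.

Set Implicit Arguments.
Unset Strict Implicit.
Unset Printing Implicit Defensive.

Import Order.TTheory GRing.Theory Num.Theory.

Local Open Scope classical_set_scope.
Local Open Scope ring_scope.

(* Points of R^n are row vectors; a finite list of m points is the m x n
   matrix whose rows are these points. *)

Definition conv_hull (R : realType) (m n : nat) (V : 'M[R]_(m, n)) :
    set 'rV[R]_n :=
  [set x | exists w : 'rV[R]_m,
     [/\ forall i, 0 <= w 0 i, \sum_i w 0 i = 1 & x = w *m V]].

(* Affine independence of the n+1 rows of V: the differences with the first
   vertex are linearly independent. *)
Definition nondegenerate (R : realType) (n : nat) (V : 'M[R]_(n.+1, n)) : bool :=
  row_free (\matrix_(i < n) (row (lift ord0 i) V - row ord0 V)).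

(* The (n-1)-dimensional face opposite to the vertex k. *)
Definition facet (R : realType) (n : nat) (V : 'M[R]_(n.+1, n))
    (k : 'I_n.+1) : set 'rV[R]_n :=
  conv_hull (row' k V).

Definition centroid (R : realType) (n : nat) (V : 'M[R]_(n.+1, n)) : 'rV[R]_n :=
  n.+1%:R^-1 *: \sum_i row i V.

Definition homothety (R : realType) (n : nat) (c : 'rV[R]_n) (s : R)
    (x : 'rV[R]_n) : 'rV[R]_n :=
  c + s *: (x - c).

(* The set sigma S, for S the simplex whose vertices are the rows of V. *)
Definition dilated_simplex (R : realType) (n : nat) (s : R)
    (V : 'M[R]_(n.+1, n)) : set 'rV[R]_n :=
  homothety (centroid V) s @` conv_hull V.

(* T is an n-dimensional simplex circumscribed around C.  The vertices W of a
   nondegenerate simplex T are determined by T up to order, so the condition on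
   the faces does not depend on the choice of W. *)
Definition circumscribed (R : realType) (n : nat) (T C : set 'rV[R]_n) : Prop :=
  exists W : 'M[R]_(n.+1, n),
    [/\ nondegenerate W, T = conv_hull W, C `<=` T &
        forall k : 'I_n.+1, (facet W k `&` C) !=set0].

Definition unit_cube (R : realType) (n : nat) : set 'rV[R]_n :=
  [set x | forall j, 0 <= x 0 j <= 1].
Arguments unit_cube R n : clear implicits.

Definition simplexT_coords (R : realType) (t : R) : seq (seq R) :=
  [:: [:: 1; 0; 0; 0;     0; 0; 1];
      [:: 1; 0; 1; t;     1; 1; 0];
      [:: 0; 1; 1; 1 - t; 0; 1; 1];
      [:: 0; 0; 0; t;     1; 1; 0];
      [:: 0; 1; 1; 1 - t; 0; 0; 0];
      [:: 1; 1; 0; t;     1; 1; 0];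
      [:: 0; 1; 1; 1 - t; 1; 0; 1];
      [:: 1; 0; 0; 1;     0; 0; 1]].

Definition simplexT (R : realType) (t : R) : 'M[R]_(8, 7) :=
  \matrix_(i < 8, j < 7) nth 0 (nth [::] (simplexT_coords t) i) j.

(* Main.v *)
Require Import Defs.
From mathcomp Require Import all_boot all_order all_algebra.
From mathcomp Require Import classical_sets reals.
From mathcomp Require Import ring lra.

(** Let lambda_j be the barycentric coordinates with respect to a nondegenerate
    simplex S with n + 1 vertices.  Dilating S by s > 0 about its centroid, where
    all lambda_j equal 1/(n+1), turns them into
      mu_j = (lambda_j + (s - 1)/(n + 1)) / s.
    Hence sS contains a convex body C and all its facets meet C exactly when
    every lambda_j has minimum -(s - 1)/(n + 1) on C.

    When C is the unit cube and lambda_j x = b_j + sum_i x_i M_ij, the minimum is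
    attained at the vertex of the cube having x_i = 1 exactly when M_ij < 0, and
    it equals b_j + sum_i min(0, M_ij).  The circumscription of the cube is thus
    a condition on the entries of M and b, which is
    [dilated_simplex_circumscribed_cube].

    For the simplex T(t) the coordinates are written down explicitly
    ([simplexT_slopes], [simplexT_offsets]); that they are correct is a matrix
    identity ([barycentric_simplexT]).  The parameter enters only two
    of the coordinate functions, through p = (4t - 1)/8 and q = (3 - 4t)/8.  For
    t between 1/4 and 3/4 both are nonnegative, and in each of these two
    functions the negative slopes depending on t are -p, -p, -q and -q.  They
    contribute the constant -2(p + q) = -1/2 to the minimum, so that all eight
    minima are -3/4 = -(7 - 1)/8 ([min_simplexT]). *)

Import Order.TTheory GRing.Theory Num.Theory.

Local Open Scope ring_scope.

(** The affine map [x |-> x *m M + b] gives the barycentric coordinates relative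
    to the rows of [V].  It is enough to ask that it send the vertices to the
    standard basis, and this form is a single matrix identity that can be
    checked entry by entry; the usual inverse description is recovered in
    [barycentric_inv]. *)
Definition barycentric {R : realType} {n : nat} (V : 'M[R]_(n.+1, n))
    (M : 'M[R]_(n, n.+1)) (b : 'rV[R]_n.+1) : Prop :=
  V *m M + const_mx 1 *m b = 1%:M.

(** [mulmx1C] across a propositional equality of sizes, needed because the block
    matrices below have sizes [n.+1] and [n + 1]. *)
Lemma mulmx1C_eqdim {R : comUnitRingType} {m p : nat} (A : 'M[R]_(m, p))
    (B : 'M[R]_(p, m)) : m = p -> A *m B = 1%:M -> B *m A = 1%:M.
Proof. by move=> e; case: p / e A B => A B; apply: mulmx1C. Qed.

Lemma mul_const1_mx {R : realType} {m : nat} (w : 'rV[R]_m) :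
  w *m const_mx 1 = (\sum_i w 0 i)%:M :> 'M_1.
Proof.
apply/rowP => j; rewrite !mxE ord1 mulr1n.
by apply: eq_bigr => i _; rewrite mxE mulr1.
Qed.

(** The defining identity says that the square matrix [row_mx V 1] has right
    inverse [col_mx M b]; this is then also a left inverse, and its four blocks
    are the required relations. *)
Lemma barycentric_inv {R : realType} {n : nat} {V : 'M[R]_(n.+1, n)} {M b} :
  barycentric V M b ->
  forall x, (x *m M + b) *m V = x /\ \sum_j (x *m M + b) 0 j = 1.
Proof.
rewrite /barycentric -mul_row_col => /(mulmx1C_eqdim _ _ (esym (addn1 n))).
rewrite mul_col_row scalar_mx_block => /eq_block_mx[]MV M1 bV b1 x; split; first by rewrite mulmxDl -mulmxA MV mulmx1 bV addr0.
have /matrixP/(_ 0 0) : (x *m M + b) *m const_mx 1 = 1%:M.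
  by rewrite mulmxDl -mulmxA M1 mulmx0 add0r.
by rewrite mul_const1_mx !mxE.
Qed.

(** Deleting from [M] the column of vertex 0 yields a right inverse of the matrix
    of edges issued from that vertex. *)
Lemma barycentric_nondegenerate {R : realType} {n : nat}
    {V : 'M[R]_(n.+1, n)} {M b} : barycentric V M b -> Defs.nondegenerate V.
Proof.
move=> VMb; apply/row_freeP; exists (col' ord0 M); apply/matrixP => i j.
have E k : (V *m M) k (lift ord0 j) = (k == lift ord0 j)%:R - b 0 (lift ord0 j).
  move/matrixP/(_ k (lift ord0 j)): VMb; rewrite mxE [in RHS]mxE => <-.
  by rewrite [(const_mx 1 *m b) _ _]mxE big_ord1 [const_mx _ _ _]mxE mul1r addrK.
transitivity ((V *m M) (lift ord0 i) (lift ord0 j)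
              - (V *m M) ord0 (lift ord0 j)).
  by rewrite !mxE -sumrB; apply: eq_bigr => k _; rewrite !mxE mulrBl.
by rewrite !E (inj_eq lift_inj) (negPf (neq_lift _ _)) !mxE opprB addrA subrK subr0.
Qed.

Lemma mem_facet {R : realType} {n : nat} (V : 'M[R]_(n.+1, n)) (k : 'I_n.+1)
    (w : 'rV[R]_n.+1) :
  (forall i, 0 <= w 0 i) -> \sum_i w 0 i = 1 -> w 0 k = 0 ->
  facet V k (w *m V).
Proof.
move=> w_ge0 w1 wk.
exists (col' k w); split=> [i||]; first by rewrite mxE.
  rewrite -w1 (bigD1_ord k) //= wk add0r.
  by apply: eq_bigr => j _; rewrite mxE.
apply/rowP => i; rewrite !mxE (bigD1_ord k) //= wk mul0r add0r.
by apply: eq_bigr => j _; rewrite !mxE.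
Qed.

(** The hypothesis says that each barycentric coordinate has minimum 0 on the
    cube: nonnegativity puts the cube in the simplex, and a zero of the k-th
    coordinate is a point of the k-th facet. *)
Lemma conv_hull_circumscribed_cube {R : realType} {n : nat}
    {V : 'M[R]_(n.+1, n)} {M b} :
  barycentric V M b ->
  (forall j, b 0 j + \sum_i Num.min 0 (M i j) = 0) ->
  circumscribed (conv_hull V) (unit_cube R n).
Proof.
move=> VMb minE.
have coord_ge0 x j : unit_cube R n x -> 0 <= (x *m M + b) 0 j.
  move=> cubex; rewrite !mxE addrC -[leLHS](minE j) lerD2l; apply: ler_sum => i _.
  by have /andP[x_ge0 x_le1] := cubex i; case: (leP 0 (M i j)) => ?; nra.
exists V; split=> //; first exact: barycentric_nondegenerate VMb.
  move=> x cubex; have [xE x1] := barycentric_inv VMb x.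
  by exists (x *m M + b); split=> // j; apply: coord_ge0.
(* The vertex of the cube minimizing the k-th coordinate. *)
move=> k; pose x : 'rV[R]_n := \row_i (M i k < 0)%R%:R.
have cubex : unit_cube R n x.
  by move=> j /=; rewrite mxE; case: (_ < _); rewrite ?ler01 ?lexx.
have w_ge0 j := coord_ge0 x j cubex; have [xE x1] := barycentric_inv VMb x.
set w := x *m M + b in w_ge0 xE x1.
have wk : w 0 k = 0.
  rewrite -[RHS](minE k) !mxE addrC; congr (_ + _); apply: eq_bigr => i _.
  by rewrite !mxE; case: (leP 0 (M i k)) => _; rewrite ?mul0r ?mul1r.
exists x; split=> //; rewrite -xE; exact: mem_facet.
Qed.

Definition dilated_vertices {R : realType} {n : nat} (s : R)
    (V : 'M[R]_(n.+1, n)) : 'M[R]_(n.+1, n) :=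
  (1 - s) *: (const_mx 1 *m centroid V) + s *: V.

(** An affine map commutes with affine combinations. *)
Lemma mulmx_dilated_vertices {R : realType} {n : nat} (s : R)
    (V : 'M[R]_(n.+1, n)) (w : 'rV[R]_n.+1) :
  \sum_i w 0 i = 1 ->
  w *m dilated_vertices s V = homothety (centroid V) s (w *m V).
Proof.
move=> w1; rewrite mulmxDr -!scalemxAr mulmxA mul_const1_mx w1 mul1mx /homothety.
by rewrite scalerBl scale1r scalerBr -addrA [- _ + _]addrC.
Qed.

Lemma dilated_simplexE {R : realType} {n : nat} (s : R)
    (V : 'M[R]_(n.+1, n)) :
  dilated_simplex s V = conv_hull (dilated_vertices s V).
Proof.
apply/seteqP; split=> [_ [_ [w [w0 w1 ->]] <-]|x [w [w0 w1 ->]]].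
  by exists w; split=> //; rewrite mulmx_dilated_vertices.
by exists (w *m V); [exists w|rewrite mulmx_dilated_vertices].
Qed.

Lemma centroidE {R : realType} {n : nat} (V : 'M[R]_(n.+1, n)) :
  centroid V = const_mx n.+1%:R^-1 *m V.
Proof.
apply/rowP => j; rewrite !mxE summxE mulr_sumr.
by apply: eq_bigr => i _; rewrite !mxE.
Qed.

(** The homothety of ratio [s] fixes the centroid, whose coordinates are all
    1/(n+1), so a new coordinate minus 1/(n+1) is the old one minus 1/(n+1),
    divided by [s]. *)
Lemma barycentric_dilated {R : realType} {n : nat} (s : R)
    (V : 'M[R]_(n.+1, n)) M b :
  s != 0 -> barycentric V M b ->
  barycentric (dilated_vertices s V) (s^-1 *: M)
    (s^-1 *: (b + const_mx ((s - 1) / n.+1%:R))).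
Proof.
move=> s0 VMb.
have VME : V *m M = 1%:M - const_mx 1 *m b by rewrite -VMb addrK.
have cME : centroid V *m M = const_mx n.+1%:R^-1 - b.
  rewrite centroidE -mulmxA VME mulmxBr mulmx1 mulmxA; congr (_ - _).
  rewrite mul_const1_mx -[RHS]mul1mx; congr (_%:M *m _).
  under eq_bigr do rewrite mxE.
  by rewrite sumr_const card_ord -[LHS]mulr_natr mulVf ?pnatr_eq0.
rewrite /barycentric /dilated_vertices; move: (centroid V) cME => c cME.
rewrite mulmxDl -!scalemxAl -!scalemxAr.
rewrite -[const_mx 1 *m _ *m M]mulmxA cME VME mulmxBr mulmxDr.
have -> : const_mx ((s - 1) / n.+1%:R)
          = (s - 1) *: const_mx n.+1%:R^-1 :> 'rV[R]_n.+1.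
  by apply/rowP => j; rewrite !mxE.
rewrite -scalemxAr; set A := _ *m b; set B := _ *m _.
by apply/matrixP => i j; rewrite !mxE; field.
Qed.

(** The left-hand side of the last hypothesis is the minimum over the cube of the
    j-th barycentric coordinate of [V]. *)
Theorem dilated_simplex_circumscribed_cube {R : realType} {n : nat} {s : R}
    {V : 'M[R]_(n.+1, n)} {M b} :
  0 < s -> barycentric V M b ->
  (forall j, b 0 j + \sum_i Num.min 0 (M i j) = - ((s - 1) / n.+1%:R)) ->
  circumscribed (dilated_simplex s V) (unit_cube R n).
Proof.
move=> s0 VMb minE; rewrite dilated_simplexE.
apply: conv_hull_circumscribed_cube (barycentric_dilated _ _ _ _ _ VMb) _.
  by rewrite gt_eqF.
move=> j; rewrite !mxE.
under eq_bigr do rewrite mxE -[X in Num.min X _](mulr0 s^-1)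
  -minr_pMr ?invr_ge0 ?ltW//.
by rewrite -mulr_sumr -mulrDr addrAC minE addNr mulr0.
Qed.

(** Found by inverting the matrix of vertices of T(t) bordered by a column of
    ones; its determinant is 8 for every t. *)
Definition simplexT_slopes {R : realType} (t : R) : 'M[R]_(7, 8) :=
  let p := (4 * t - 1) / 8 in let q := (3 - 4 * t) / 8 in
  \matrix_(i < 7, j < 8) nth 0 (nth [::]
  [:: [::   p;  3/8; -1/8; -5/8; -1/8;  3/8; -1/8;   q];
      [:: - p; -3/8;  1/8; -3/8;  1/8;  5/8;  1/8; - q];
      [:: - p;  5/8;  1/8; -3/8;  1/8; -3/8;  1/8; - q];
      [::  -1;    0;    0;    0;    0;    0;    0;   1];
      [:: - q;  1/8; -3/8;  1/8; -3/8;  1/8;  5/8; - p];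
      [:: - q;  1/8;  5/8;  1/8; -3/8;  1/8; -3/8; - p];
      [::   q; -1/8;  3/8; -1/8; -5/8; -1/8;  3/8;   p]] i) j.

Definition simplexT_offsets {R : realType} : 'rV[R]_8 :=
  \row_(j < 8) nth 0 [:: 3/4; -1/4; -1/4; 3/4; 3/4; -1/4; -1/4; -1/4] j.

Lemma barycentric_simplexT {R : realType} (t : R) :
  barycentric (simplexT t) (simplexT_slopes t) simplexT_offsets.
Proof.
apply/matrixP => i j; rewrite !mxE big_ord1.
under eq_bigr do rewrite !mxE.
rewrite !big_ord_recr big_ord0 !mxE /=.
by case: i => [[|[|[|[|[|[|[|[|//]]]]]]]] ?];
  case: j => [[|[|[|[|[|[|[|[|//]]]]]]]] ?]; rewrite /= ?mulr1n ?mulr0n; field.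
Qed.

(** The bounds on [t] make p and q nonnegative, which fixes the signs in columns
    0 and 7; outside the interval these two minima drop below -3/4. *)
Lemma min_simplexT {R : realType} (t : R) (j : 'I_8) :
  1 / 4 <= t <= 3 / 4 ->
  simplexT_offsets 0 j + \sum_i Num.min 0 (simplexT_slopes t i j) = - (3 / 4).
Proof.
case/andP=> t1 t3.
under eq_bigr do rewrite !mxE.
rewrite !big_ord_recr big_ord0 !mxE /=.
case: j => [[|[|[|[|[|[|[|[|//]]]]]]]] ?] /=;
  by repeat (first [rewrite min_l; last by lra | rewrite min_r; last by lra]);
  lra.
Qed.

Theorem theorem5 (R : realType) (t : R) (ht : 1 / 4 <= t <= 3 / 4) :
  circumscribed (dilated_simplex 7 (simplexT t)) (unit_cube R 7).
Proof.
apply: (dilated_simplex_circumscribed_cube _ (barycentric_simplexT t)) => [//|j].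
by rewrite min_simplexT //; lra.
Qed.
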